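(* Let $n\ge 2$ be an integer. For an integer $k$ with $2\le k\le n$, put $$\Lambda_1=\{(k_1+1,k_2,\ldots,k_{n-k+1}) : (k_1,k_2,\ldots,k_{n-k+1})\in\Lambda^{k-1}_{n-1}\},$$ and, when $2\le k\le [n/2]$, put $$\Lambda_2=\{(0,k_1,k_2,\ldots,k_{n-2k+1},\underbrace{0,0,\ldots,0}_{k-1\ \text{times}}) : (k_1,k_2,\ldots,k_{n-2k+1})\in\Lambda^{k}_{n-k}\}.$$ If $2\le k\le [n/2]$, then $\Lambda^k_n=\Lambda_1\cup\Lambda_2$. If $[n/2]<k\le n$, then $\Lambda^k_n=\Lambda_1$.
   Context: $\mathbb{N}_0=\{0,1,2,\ldots\}$ and $[x]$ denotes the integer part of $x$. For integers $1\le k\le n$, the partition set is $$\Lambda^k_n=\Big\{(k_1,k_2,\ldots,k_{n-k+1}) : \sum_{j=1}^{n-k+1}k_j=k,\ \sum_{j=1}^{n-k+1}jk_j=n,\ k_j\in\mathbb{N}_0\Big\}\subset\mathbb{N}_0^{n-k+1}.$$ *)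

(* Defs.v *)
From mathcomp Require Import all_boot.
From mathcomp Require Import classical_sets.

Set Implicit Arguments.
Unset Strict Implicit.
Unset Printing Implicit Defensive.

Local Open Scope classical_set_scope.
Local Open Scope nat_scope.

(* N_0^m is represented by the sequences of naturals of size m; entries are
   numbered from 0, so nth 0 s j is the paper's k_(j+1). The set is meant for
   1 <= k <= n, where the subtraction below is not truncated. *)
Definition Lambda (n k : nat) : set (seq nat) :=
  [set s | [/\ size s = n - k + 1,
               \sum_(j < n - k + 1) nth 0 s j = k
             & \sum_(j < n - k + 1) j.+1 * nth 0 s j = n]].

Definition Lambda1 (n k : nat) : set (seq nat) :=
  [set incr_nth s 0 | s in Lambda (n - 1) (k - 1)].

Definition Lambda2 (n k : nat) : set (seq nat) :=
  [set 0 :: s ++ nseq (k - 1) 0 | s in Lambda (n - k) k].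

(* Main.v *)
(* A sequence s of Lambda n k either has a positive head, which can be
   decremented (the part Lambda1), or reads 0 :: t. In the latter case t has sum
   k and weighted sum n - k, so that 2k <= n; a nonzero entry of t at the
   0-based position i forces i + k <= n - k, hence the last k - 1 entries of t
   vanish and s lies in Lambda2. *)
Require Import Defs.
From mathcomp Require Import all_boot.
From mathcomp Require Import classical_sets.
From mathcomp Require Import zify.

Local Open Scope classical_set_scope.
Local Open Scope nat_scope.

(** The weighted sum in recursive form: putting [a] in front moves every entry of [t] one place to
    the right, which adds [sumn t] to its weight. *)
Fixpoint weight (s : seq nat) : nat :=
  if s is a :: t then a + sumn t + weight t else 0.

Lemma sumn_nth (s : seq nat) : \sum_(j < size s) nth 0 s j = sumn s.
Proof. by rewrite sumnE (big_nth 0) big_mkord. Qed.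

Lemma weightE (s : seq nat) : \sum_(j < size s) j.+1 * nth 0 s j = weight s.
Proof.
elim: s => [|a t IHt] /=; first by rewrite big_ord0.
rewrite big_ord_recl /= mul1n -addnA -IHt -sumn_nth -big_split /=.
by congr (_ + _); apply: eq_bigr => i _; rewrite [in LHS]mulSn.
Qed.

(** With recursive functions in place of indexed sums, membership of a sequence [a :: t] simplifies
    to linear arithmetic. *)
Lemma LambdaP (n k : nat) (s : seq nat) :
  Lambda n k s <-> [/\ size s = n - k + 1, sumn s = k & weight s = n].
Proof.
split=> -[sz_s].
  by rewrite -sz_s sumn_nth weightE.
by rewrite /Lambda /= -sz_s sumn_nth weightE.
Qed.

Lemma leq_sumn_weight (s : seq nat) : sumn s <= weight s.
Proof. by case: s => //= a t; apply: leq_addr. Qed.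

Lemma sumn_cat_nseq0 (s : seq nat) (m : nat) : sumn (s ++ nseq m 0) = sumn s.
Proof. by rewrite sumn_cat sumn_nseq mul0n addn0. Qed.

Lemma weight_cat_nseq0 (s : seq nat) (m : nat) :
  weight (s ++ nseq m 0) = weight s.
Proof.
elim: s => [|a t IHt] /=; last by rewrite sumn_cat_nseq0 IHt.
by elim: m => //= m ->; rewrite sumn_nseq.
Qed.

Lemma leq_nth_sumn (s : seq nat) (i : nat) : nth 0 s i <= sumn s.
Proof.
elim: s i => [|a t IHt] [|i] //=; first exact: leq_addr.
exact: leq_trans (IHt i) (leq_addl _ _).
Qed.

(** Each unit of the sum has weight at least 1, and a unit at the 0-based position [i] has weight
    [i + 1], an excess of [i]. *)
Lemma leq_index_weight (s : seq nat) (i : nat) :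
  0 < nth 0 s i -> i + sumn s <= weight s.
Proof.
elim: s i => [|a t IHt] [|i] //= nz_i; first exact: leq_addr.
have := IHt _ nz_i; have := leq_nth_sumn t i; lia.
Qed.

Lemma cat_take_nseq0 (s : seq nat) (m : nat) :
  (forall i, m <= i -> nth 0 s i = 0) ->
  s = take m s ++ nseq (size s - m) 0.
Proof.
move=> s0; rewrite -[LHS](cat_take_drop m); congr (_ ++ _).
apply: (@eq_from_nth _ 0) => [|i _]; first by rewrite size_drop size_nseq.
by rewrite nth_drop nth_nseq if_same s0 ?leq_addr.
Qed.

Lemma Lambda1_sub (n k : nat) : 2 <= k <= n -> Lambda1 n k `<=` Lambda n k.
Proof.
move=> kn s [t /LambdaP[]]; case: t => [|a t] /= sz_t sum_t wt_t <-; first lia.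
by apply/LambdaP; split=> /=; lia.
Qed.

(** The leading 0 raises the weight from [n - k] to [n] and the trailing zeros leave it unchanged;
    since [2k <= n], the length is [1 + (n - 2k + 1) + (k - 1) = n - k + 1]. *)
Lemma Lambda2_sub (n k : nat) :
  2 <= k -> k <= n./2 -> Lambda2 n k `<=` Lambda n k.
Proof.
move=> k2 kn s [t /LambdaP[sz_t sum_t wt_t] <-]; apply/LambdaP.
rewrite /= size_cat size_nseq sumn_cat_nseq0 weight_cat_nseq0.
by split; lia.
Qed.

Lemma Lambda_cons_Lambda1 (n k a : nat) (t : seq nat) :
  1 <= k <= n -> 0 < a -> Lambda n k (a :: t) -> Lambda1 n k (a :: t).
Proof.
case: a => // a kn _ /LambdaP[/= sz_t sum_t wt_t].
by exists (a :: t) => //; apply/LambdaP; split=> /=; lia.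
Qed.

Lemma Lambda_cons0_leq (n k : nat) (t : seq nat) :
  Lambda n k (0 :: t) -> k <= n./2.
Proof.
by move=> /LambdaP[/= _ sum_t wt_t]; have := leq_sumn_weight t; lia.
Qed.

Lemma Lambda_cons0_Lambda2 (n k : nat) (t : seq nat) :
  0 < k -> Lambda n k (0 :: t) -> Lambda2 n k (0 :: t).
Proof.
move=> k0 Lt; have kn := Lambda_cons0_leq _ _ _ Lt.
move: Lt => /LambdaP[/= sz_t sum_t wt_t].
(* [m] is the length of the members of [Lambda (n - k) k]; by [kn] the subtractions are not
   truncated. *)
set m := n - k - k + 1.
have t0 i : m <= i -> nth 0 t i = 0.
  move=> mi; apply/eqP; rewrite eqn0Ngt; apply/negP => /leq_index_weight.
  by rewrite /m in mi; lia.
have tE := cat_take_nseq0 _ _ t0.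
have sz_m : size t - m = k - 1 by rewrite /m; lia.
rewrite sz_m in tE.
exists (take m t); last by rewrite -tE.
apply/LambdaP; split.
- by rewrite size_take_min; apply/minn_idPl; rewrite /m; lia.
- by rewrite -(sumn_cat_nseq0 _ (k - 1)) -tE.
- by rewrite -(weight_cat_nseq0 _ (k - 1)) -tE; lia.
Qed.

Theorem theorem2p2 (n k : nat) (hn : 2 <= n) (hk : 2 <= k <= n) :
  (k <= n./2 -> Lambda n k = Lambda1 n k `|` Lambda2 n k) /\
  (n./2 < k -> Lambda n k = Lambda1 n k).
Proof.
have [k2 kn] := andP hk; have k1 : 1 <= k <= n by rewrite kn ltnW.
split=> kn2; apply/seteqP; split.
- move=> [|[|a] t] Ls; first by case/LambdaP: Ls => /= sz_s; lia.
    by right; apply: Lambda_cons0_Lambda2 => //; apply: ltnW.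
  by left; apply: Lambda_cons_Lambda1.
- by move=> s [/(Lambda1_sub _ _ hk _) | /(Lambda2_sub _ _ k2 kn2 _)].
(* The length [n - k + 1] excludes the empty sequence, and a zero head would force [k <= n./2]. *)
- move=> [|[|a] t] Ls; first by case/LambdaP: Ls => /= sz_s; lia.
    by have := Lambda_cons0_leq _ _ _ Ls; rewrite leqNgt kn2.
  by apply: Lambda_cons_Lambda1.
- exact: Lambda1_sub.
Qed.
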